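(* Let $M,N\in\mathbb{N}$ with $M,N>1$ have prime factorizations $M=p_1^{k_1}\cdots p_m^{k_m}$ and $N=q_1^{l_1}\cdots q_n^{l_n}$, where $p_1<\cdots<p_m$ and $q_1<\cdots<q_n$ are primes and all exponents are positive integers. If the sets $\{p_1,\dots,p_m\}$ and $\{q_1,\dots,q_n\}$ do not coincide, then the two-sided full shifts $(\bar X_M,\bar\sigma_M)$ and $(\bar X_N,\bar\sigma_N)$ are not asymptotically continuously orbit equivalent.
   Context: The two-sided full $N$-shift is $\bar X_N=\{1,\dots,N\}^{\mathbb{Z}}$ with the product topology and $\bar\sigma_N((x_n)_n)=(x_{n+1})_n$. Write $(X,\phi)=(\bar X_M,\bar\sigma_M)$ and $(Y,\psi)=(\bar X_N,\bar\sigma_N)$. For a full shift $(X,\phi)$ let $G_\phi^{a,n}=\{(x,y)\in X\times X: x_i=y_i\text{ for all }|i|\ge n\}$, $n\ge0$, with the relative topology, and $G_\phi^a=\bigcup_nG_\phi^{a,n}$ with the inductive limit topology (similarly $G_\psi^a$). For continuous $f:X\to\mathbb{Z}$ put $f^n(x)=\sum_{i=0}^{n-1}f(\phi^i(x))$ for $n>0$, $f^0=0$, $f^n(x)=-\sum_{i=n}^{-1}f(\phi^i(x))$ for $n<0$ (similarly on $Y$ with $\psi$). A two-cocycle on $G_\phi^a$ is a continuous $d:G_\phi^a\to\mathbb{Z}$ with $d(x,z)+d(z,w)=d(x,w)$. $(X,\phi)$ and $(Y,\psi)$ are asymptotically continuously orbit equivalent if there exist a homeomorphism $h:X\to Y$,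 continuous $c_1:X\to\mathbb{Z}$, $c_2:Y\to\mathbb{Z}$ and two-cocycles $d_1:G_\phi^a\to\mathbb{Z}$, $d_2:G_\psi^a\to\mathbb{Z}$ such that (1) $c_1^m(x)+d_1(\phi^m(x),\phi^m(z))=c_1^m(z)+d_1(x,z)$ for $(x,z)\in G_\phi^a$, $m\in\mathbb{Z}$; (2) $c_2^m(y)+d_2(\psi^m(y),\psi^m(w))=c_2^m(w)+d_2(y,w)$ for $(y,w)\in G_\psi^a$, $m\in\mathbb{Z}$; (i) for each $n\in\mathbb{Z}$, $x\mapsto(\psi^{c_1^n(x)}(h(x)),h(\phi^n(x)))$ is a continuous map from $X$ into $G_\psi^a$; (ii) for each $n\in\mathbb{Z}$, $y\mapsto(\phi^{c_2^n(y)}(h^{-1}(y)),h^{-1}(\psi^n(y)))$ is a continuous map from $Y$ into $G_\phi^a$; (iii) $(x,z)\mapsto(\psi^{d_1(x,z)}(h(x)),h(z))$ is a continuous map from $G_\phi^a$ into $G_\psi^a$; (iv) $(y,w)\mapsto(\phi^{d_2(y,w)}(h^{-1}(y)),h^{-1}(w))$ is a continuous map from $G_\psi^a$ into $G_\phi^a$; (v) $c_2^{c_1^n(x)}(h(x))+d_2(\psi^{c_1^n(x)}(h(x)),h(\phi^n(x)))=n$ for $x\in X$, $n\in\mathbb{Z}$; (vi) $c_1^{c_2^n(y)}(h^{-1}(y))+d_1(\phi^{c_2^n(y)}(h^{-1}(y)),h^{-1}(\psi^n(y)))=n$ for $y\in Y$, $n\in\mathbb{Z}$; (vii) $c_2^{d_1(x,z)}(h(x))+d_2(\psi^{d_1(x,z)}(h(x)),h(z))=0$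 for $(x,z)\in G_\phi^a$; (viii) $c_1^{d_2(y,w)}(h^{-1}(y))+d_1(\phi^{d_2(y,w)}(h^{-1}(y)),h^{-1}(w))=0$ for $(y,w)\in G_\psi^a$. *)

(* Defs.v *)
From HB Require Import structures.
From mathcomp Require Import all_boot all_order all_algebra.
From mathcomp Require Import all_classical.
From mathcomp Require Import topology.

Set Implicit Arguments.
Unset Strict Implicit.
Unset Printing Implicit Defensive.

Import Order.TTheory GRing.Theory Num.Theory.
Local Open Scope classical_set_scope.
Local Open Scope ring_scope.

(* The alphabet {1, .., N} is relabelled as 'I_N = {0, .., N - 1}. *)
Definition full_shift (N : nat) : topologicalType :=
  prod_topology (fun _ : int => discrete_topology 'I_N).

(* mathcomp-analysis puts no topology on int. *)
Definition Zdisc : topologicalType := discrete_topology int.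

Section FullShift.
Variable N : nat.
Local Notation X := (full_shift N).

Definition shift (x : X) : X := fun i => x (i + 1).
Definition unshift (x : X) : X := fun i => x (i - 1).

Lemma shiftK : cancel shift unshift.
Proof.
by move=> x; apply: functional_extensionality_dep => i;
   rewrite /shift /unshift subrK.
Qed.

Lemma unshiftK : cancel unshift shift.
Proof.
by move=> x; apply: functional_extensionality_dep => i;
   rewrite /shift /unshift addrK.
Qed.

(* The integer powers of the shift; [Negz k] is - (k + 1). *)
Definition shiftz (n : int) (x : X) : X :=
  match n with
  | Posz k => iter k shift x
  | Negz k => iter k.+1 unshift x
  end.

Lemma shiftzE n x i : shiftz n x i = x (i + n).
Proof.
case: n => k /=.
  elim: k i => [|k IH] i /=; first by rewrite addr0.
  by rewrite /shift IH -addrA -intS.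
rewrite -[unshift _]/(iter k.+1 unshift x).
elim: k i => [|k IH] i //.
by rewrite iterS /unshift IH -addrA !NegzE -opprD -intS.
Qed.

Definition cosum (f : X -> int) (n : int) (x : X) : int :=
  match n with
  | Posz k => \sum_(i < k) f (shiftz i%:Z x)
  | Negz k => - \sum_(i < k.+1) f (shiftz (- i.+1%:Z) x)
  end.

Definition asymp_at (n : nat) : set (X * X) :=
  [set p | forall i : int, (n <= `|i|)%N -> p.1 i = p.2 i].

Definition asymp : set (X * X) := \bigcup_n asymp_at n.

(* The alias hides the subspace topology that [set_type asymp] inherits from
   X * X: it is strictly coarser than the inductive limit topology below. *)
Definition asymp_groupoid : Type := set_type asymp.
HB.instance Definition _ := Choice.on asymp_groupoid.

Lemma asymp_at_sub n (p : X * X) : p \in asymp_at n -> p \in asymp.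
Proof. by rewrite !inE => pn; exists n. Qed.

Definition asymp_incl n (p : set_type (asymp_at n)) : asymp_groupoid :=
  exist _ (val p) (asymp_at_sub (valP p)).

Definition indlim_open (U : set asymp_groupoid) : Prop :=
  forall n, open (@asymp_incl n @^-1` U).

Lemma indlim_openT : indlim_open setT.
Proof. by move=> n; rewrite preimage_setT; exact: openT. Qed.

Lemma indlim_openI : setI_closed indlim_open.
Proof. by move=> A B oA oB n; rewrite preimage_setI; exact: openI. Qed.

Lemma indlim_open_bigU (I : Type) (F : I -> set asymp_groupoid) :
  (forall i, indlim_open (F i)) -> indlim_open (\bigcup_i F i).
Proof.
by move=> oF n; rewrite preimage_bigcup; apply: bigcup_open => i _; exact: oF.
Qed.

HB.instance Definition _ := isOpenTopological.Build asymp_groupoid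
  indlim_openT indlim_openI indlim_open_bigU.

Lemma asymp_groupoid_openE (U : set asymp_groupoid) : open U = indlim_open U.
Proof. by []. Qed.

Definition agval (p : asymp_groupoid) : X * X := set_val p.
Definition asrc (p : asymp_groupoid) : X := (agval p).1.
Definition atgt (p : asymp_groupoid) : X := (agval p).2.

Lemma asymp_shiftz (m : int) (p : X * X) :
  p \in asymp -> (shiftz m p.1, shiftz m p.2) \in asymp.
Proof.
rewrite !inE => -[n _ pn]; exists (n + `|m|)%N => // i ni /=.
rewrite !shiftzE; apply: pn; rewrite -(leq_add2r `|m|%N).
apply: leq_trans ni _; rewrite -{1}[i](addrK m).
by rewrite (leq_trans (leqD_dist _ 0 _))// ?addr0 ?sub0r ?abszN.
Qed.

Definition agshift (m : int) (p : asymp_groupoid) : asymp_groupoid :=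
  exist _ (shiftz m (asrc p), shiftz m (atgt p)) (asymp_shiftz m (valP p)).

Definition two_cocycle (d : asymp_groupoid -> int) : Prop :=
  continuous (d : asymp_groupoid -> Zdisc) /\
  forall p q r : asymp_groupoid,
    atgt p = asrc q -> asrc r = asrc p -> atgt r = atgt q ->
    d p + d q = d r.

(* [F] is the map [t |-> (a t, b t)], as a continuous map into the groupoid. *)
Definition continuous_pairing (T : topologicalType) (a b : T -> X)
    (F : T -> asymp_groupoid) : Prop :=
  continuous F /\ forall t, agval (F t) = (a t, b t).

End FullShift.

Section OrbitEquivalence.
Variables M N : nat.
Local Notation X := (full_shift M).
Local Notation Y := (full_shift N).
Local Notation GX := (asymp_groupoid M).
Local Notation GY := (asymp_groupoid N).

(* The fields [acoe1] to [acoe_viii] are the conditions (1), (2), (i)-(viii) of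
   asymptotic continuous orbit equivalence, with [k] the inverse of [h].
   [Fi], .., [Fiv] are the maps of (i)-(iv); having values in the groupoid
   types, they supply the arguments of [d1] and [d2] in (v)-(viii). *)
Record acoe_data (h : X -> Y) (k : Y -> X) (c1 : X -> int) (c2 : Y -> int)
    (d1 : GX -> int) (d2 : GY -> int) (Fi : int -> X -> GY)
    (Fii : int -> Y -> GX) (Fiii : GX -> GY) (Fiv : GY -> GX) : Prop :=
  AcoeData {
  acoe_hK : cancel h k;
  acoe_kK : cancel k h;
  acoe_h_cont : continuous h;
  acoe_k_cont : continuous k;
  acoe_c1_cont : continuous (c1 : X -> Zdisc);
  acoe_c2_cont : continuous (c2 : Y -> Zdisc);
  acoe_d1_cocycle : two_cocycle d1;
  acoe_d2_cocycle : two_cocycle d2;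
  acoe1 : forall (p : GX) (m : int),
    cosum c1 m (asrc p) + d1 (agshift m p) = cosum c1 m (atgt p) + d1 p;
  acoe2 : forall (q : GY) (m : int),
    cosum c2 m (asrc q) + d2 (agshift m q) = cosum c2 m (atgt q) + d2 q;
  acoe_i : forall n : int, continuous_pairing
    (fun x => shiftz (cosum c1 n x) (h x)) (fun x => h (shiftz n x)) (Fi n);
  acoe_ii : forall n : int, continuous_pairing
    (fun y => shiftz (cosum c2 n y) (k y)) (fun y => k (shiftz n y)) (Fii n);
  acoe_iii : continuous_pairing
    (fun p => shiftz (d1 p) (h (asrc p))) (fun p => h (atgt p)) Fiii;
  acoe_iv : continuous_pairing
    (fun q => shiftz (d2 q) (k (asrc q))) (fun q => k (atgt q)) Fiv;
  acoe_v : forall (x : X) (n : int),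
    cosum c2 (cosum c1 n x) (h x) + d2 (Fi n x) = n;
  acoe_vi : forall (y : Y) (n : int),
    cosum c1 (cosum c2 n y) (k y) + d1 (Fii n y) = n;
  acoe_vii : forall p : GX, cosum c2 (d1 p) (h (asrc p)) + d2 (Fiii p) = 0;
  acoe_viii : forall q : GY, cosum c1 (d2 q) (k (asrc q)) + d1 (Fiv q) = 0
}.

Definition asymp_cont_orbit_equiv : Prop :=
  exists h k c1 c2 d1 d2 Fi Fii Fiii Fiv,
    @acoe_data h k c1 c2 d1 d2 Fi Fii Fiii Fiv.

End OrbitEquivalence.

(* Main.v *)
Require Import Defs.
From mathcomp Require Import all_boot all_order all_algebra.
From mathcomp Require Import all_classical.
From mathcomp Require Import topology.
From mathcomp Require Import perm zify.

Set Implicit Arguments.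
Unset Strict Implicit.
Unset Printing Implicit Defensive.

Import Order.TTheory GRing.Theory Num.Theory.
Local Open Scope classical_set_scope.
Local Open Scope ring_scope.

(* The uniform Bernoulli measure is the only probability measure invariant under
   the groupoid, so the orbit equivalence [h] preserves it.  The clopen sets
   [{x | h x 0 = a}], for the [N] letters [a], thus have measure 1/N in Z[1/M]:
   N divides a power of M, and symmetrically.  Measures are avoided by counting
   points of large odd period: exchanging the letters [a] and [b] at coordinate
   0 of [h x] is conjugated by [h] to an involution [theta] of the M-shift, and
   by condition (iv) and compactness [theta x] is, outside a fixed window, [x]
   shifted by a bounded locally constant amount.  So [theta] induces an
   injection between the periodic points of the two sets. *)

(** * Cylinder neighbourhoods and compactness of the full shift *)

Definition agree (N K : nat) (x z : full_shift N) : Prop :=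
  forall i : int, (`|i| <= K)%N -> x i = z i.

Lemma cvg_full_shiftP (N : nat) (F : set_system (full_shift N))
    (x : full_shift N) :
  Filter F -> F --> x <-> forall i, \forall z \near F, z i = x i.
Proof.
move=> FF; split=> [Fx i|Fx].
  have : nbhs x (proj i @^-1` [set x i]).
    apply: proj_continuous; exact: (@discrete_set1 (discrete_topology 'I_N)).
  exact: Fx.
apply/cvg_sup => i A /= [_ [[B _ <-] Bx] BA].
by apply: filterS (Fx i) => z zx; apply: BA; rewrite /= zx.
Qed.

Lemma near_eq_coord (N : nat) (x : full_shift N) (i : int) :
  \forall z \near x, z i = x i.
Proof. exact: ((cvg_full_shiftP x (nbhs_filter x)).1 cvg_id i). Qed.

Lemma near_agree (N K : nat) (x : full_shift N) :
  \forall z \near x, agree K x z.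
Proof.
have: \forall z \near x, forall j : 'I_K.+1,
    z j%:Z = x j%:Z /\ z (- j%:Z) = x (- j%:Z).
  apply: (@filter_forall _ _ _ (nbhs x)) => j.
  by apply: filterI; exact: near_eq_coord.
apply: filterS => z zx i iK.
have [] := zx (Ordinal (iK : (`|i| < K.+1)%N)).
by case: (intP i) iK => [|n|n] _ /=; rewrite ?abszN ?absz_nat.
Qed.

(** The filter generated by the windows around [x] converges to [x] in each coordinate, hence in the
    product topology. *)
Lemma agree_sub_nbhs (N : nat) (x : full_shift N) (U : set (full_shift N)) :
  nbhs x U -> exists K, forall z, agree K x z -> U z.
Proof.
pose F := filter_from [set: nat] (fun K => [set z | agree K x z]).
have FF : Filter F.
  apply: filter_from_filter; first by exists 0%N.
  move=> K L _ _; exists (maxn K L) => // z xz.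
  by split=> i iK; apply: xz; rewrite leq_max iK ?orbT.
have Fx : F --> x.
  apply/cvg_full_shiftP => i; exists `|i|%N => // z xz; exact/esym/xz.
by move=> /Fx [K _ KU]; exists K.
Qed.

Lemma agreeW (N K L : nat) (x z : full_shift N) :
  (K <= L)%N -> agree L x z -> agree K x z.
Proof. by move=> KL xz i iK; apply: xz; exact: leq_trans KL. Qed.

Lemma agree_trans (N K : nat) (x y z : full_shift N) :
  agree K x y -> agree K y z -> agree K x z.
Proof. by move=> xy yz i iK; rewrite xy// yz. Qed.

(** Tychonoff's theorem, in near-covering form, turns local thresholds into a uniform one. *)
Lemma full_shift_near (N : nat) (P : nat -> full_shift N -> Prop) :
  (forall x : full_shift N, \forall x' \near x & K \near \oo, P K x') ->
  \forall K \near \oo, forall x, P K x.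
Proof.
move=> nearP.
have XK : compact [set: full_shift N].
  have -> : [set: full_shift N] =
      [set f | forall i, [set: discrete_topology 'I_N] (f i)].
    by apply/seteqP; split.
  apply: (@tychonoff _ (fun _ : int => discrete_topology 'I_N)
    (fun=> [set: discrete_topology 'I_N])) => _.
  exact/finite_compact/(@finite_finset 'I_N).
have /compact_near_coveringP/(_ _ _ P) nc := XK.
by apply: filterS (nc \oo _ (fun x _ => nearP x)) => K + x; apply.
Qed.

(** By compactness one window size serves all points: a point agreeing on a larger window with a
    member of a cylinder stays in that cylinder. *)
Lemma uniformly_locally_constant (N : nat) (T : Type) (f : full_shift N -> T) :
  (forall x : full_shift N, \forall z \near x, f z = f x) ->
  \forall K \near \oo, forall x z, agree K x z -> f x = f z.
Proof.
move=> fc.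
apply: (@full_shift_near _ (fun K x => forall z, agree K x z -> f x = f z)).
move=> x; have [K fK] := agree_sub_nbhs (fc x).
exists ([set z | agree K x z], [set L | K <= L]%N).
  by split; [exact: near_agree|exact: nbhs_infty_ge].
move=> [z L] /= [xz KL] w zw; rewrite (fK _ xz) fK//.
exact: agree_trans xz (agreeW KL zw).
Qed.

Lemma locally_constant_bounded (N : nat) (f : full_shift N -> nat) :
  (forall x : full_shift N, \forall z \near x, f z = f x) ->
  \forall K \near \oo, forall x, (f x <= K)%N.
Proof.
move=> fc; apply: (@full_shift_near _ (fun K x => f x <= K)%N) => x.
exists ([set z | f z = f x], [set L | f x <= L]%N).
  by split; [exact: fc|exact: nbhs_infty_ge].
by move=> [z L] /= [->].
Qed.

(** * Counting periodic points *)

(* The point of period [2S + 1] whose restriction to [-S, S] is [f]. *)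
Definition per (N S : nat) (f : {ffun 'I_S.*2.+1 -> 'I_N}) : full_shift N :=
  fun i => f (inord `|((i + S%:Z) %% S.*2.+1%:Z)%Z|%N).

Lemma per_mod (N S : nat) (f : {ffun 'I_S.*2.+1 -> 'I_N}) (i j : int) :
  (i = j %[mod S.*2.+1%:Z])%Z -> per f i = per f j.
Proof. by move=> ij; rewrite /per -modzDml ij modzDml. Qed.

Lemma per_window (N S : nat) (f : {ffun 'I_S.*2.+1 -> 'I_N}) (i : int) :
  (`|i| <= S)%N -> per f i = f (inord `|(i + S%:Z)%R|%N).
Proof.
by move=> iS; rewrite /per modz_small//; apply/andP; split; lia.
Qed.

Lemma per_ord (N S : nat) (f : {ffun 'I_S.*2.+1 -> 'I_N}) (j : 'I_S.*2.+1) :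
  per f (j%:Z - S%:Z) = f j.
Proof.
by rewrite per_window ?subrK ?absz_nat ?inord_val//; have := ltn_ord j; lia.
Qed.

Lemma per_inj (N S : nat) (f g : {ffun 'I_S.*2.+1 -> 'I_N}) :
  (forall i, per f i = per g i) -> f = g.
Proof. by move=> fg; apply/ffunP => j; rewrite -per_ord fg per_ord. Qed.

Lemma window_repr (S : nat) (i : int) :
  exists2 j : int, (`|j| <= S)%N & (j = i %[mod S.*2.+1%:Z])%Z.
Proof.
exists (((i + S%:Z) %% S.*2.+1%:Z)%Z - S%:Z).
  have := @modz_ge0 (i + S%:Z) S.*2.+1%:Z isT.
  have := @ltz_pmod (i + S%:Z) S.*2.+1%:Z isT.
  by lia.
by rewrite modzDml addrK.
Qed.

(* Restricting [theta (per f)] to [-S, S] and extending it periodically again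
   is injective in [f]: the inverse [theta] recovers [per f] near the origin,
   hence the displacement [e (per f)], and then [per f] everywhere by
   periodicity. *)
Lemma card_per_le (N L K S : nat) (theta : full_shift N -> full_shift N)
    (e : full_shift N -> int) (A B : full_shift N -> bool) :
  involutive theta ->
  (forall x, `|e x| <= K)%N ->
  (forall x i, (L <= `|i|)%N -> theta x i = x (i + e x)) ->
  (forall x z, agree K x z -> e x = e z) ->
  (forall x z, agree K x z -> agree L (theta x) (theta z)) ->
  (forall x, A x -> B (theta x)) ->
  (forall x z, agree K x z -> B x = B z) ->
  (K.*2 + L <= S)%N ->
  (#|[pred f : {ffun 'I_S.*2.+1 -> 'I_N} | A (per f)]| <=
   #|[pred f : {ffun 'I_S.*2.+1 -> 'I_N} | B (per f)]|)%N.
Proof.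
move=> thetaK eK thetaE eloc thetaloc AB Bloc KLS.
pose G (f : {ffun 'I_S.*2.+1 -> 'I_N}) : {ffun 'I_S.*2.+1 -> 'I_N} :=
  [ffun j : 'I_S.*2.+1 => theta (per f) (j%:Z - S%:Z)].
have perG f : agree S (theta (per f)) (per (G f)).
  move=> i iS; rewrite per_window// ffunE inordK; last by lia.
  by congr (theta _ _); lia.
have Ginj : injective G.
  move=> f g Gfg; apply: per_inj.
  set x := per f; set z := per g.
  have txz : agree S (theta x) (theta z).
    by move=> i iS; rewrite perG// Gfg -perG.
  have xz : agree (S - K)%N x z.
    move=> i iS; rewrite -(thetaK x) -(thetaK z).
    have txzK : agree K (theta x) (theta z) by apply: agreeW txz; lia.
    have [iL|iL] := leqP L `|i|%N; last by apply: thetaloc => //; lia.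
    (* Both points are read off [theta x] and [theta z] with the same displacement, of size at most
       [K]; hence the loss from [S] to [S - K]. *)
    rewrite [LHS]thetaE// [RHS]thetaE// (eloc _ _ txzK); apply: txz.
    by have := eK (theta z); lia.
  have exz : e x = e z by apply: eloc; apply: agreeW xz; lia.
  move=> i; have [j jS ji] := window_repr S (i - e x).
  have jei : (j + e x = i %[mod S.*2.+1%:Z])%Z.
    by rewrite -modzDml ji modzDml subrK.
  rewrite /x /z -!(per_mod _ jei) -/x -/z.
  have [jL|jL] := leqP L `|j|%N.
    by rewrite -thetaE// exz -thetaE//; exact: txz.
  (* Here [j + e x] is smaller than [L + K] in absolute value, and [L + K <= S - K]. *)
  by apply: xz; move: (eK x) jL KLS; clear; lia.
rewrite -(fintype.card_image Ginj); apply: subset_leq_card.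
apply/fintype.subsetP => g.
move=> /fintype.imageP[f]; rewrite !inE => /AB Bf ->.
(* Although [theta (per f)] need not be periodic, [B] sees only the window [[-K, K]], where it
   agrees with [per (G f)]. *)
by rewrite -(Bloc (theta (per f)))//; apply: agreeW (perG f); lia.
Qed.

(** * Exchanging two letters, and the topology of the groupoid *)

Definition swap0 (N : nat) (a b : 'I_N) (y : full_shift N) : full_shift N :=
  fun i => if i == 0 then tperm a b (y i) else y i.

Lemma swap0K (N : nat) (a b : 'I_N) : involutive (swap0 a b).
Proof.
move=> y; apply: functional_extensionality_dep => i.
by rewrite /swap0; case: eqP => // _; rewrite tpermK.
Qed.

Lemma swap0_continuous (N : nat) (a b : 'I_N) : continuous (swap0 a b).
Proof.
move=> y; apply: (cvg_full_shiftP _ (fmap_filter _ (nbhs_filter y))).2 => i.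
by apply: filterS (near_eq_coord y i) => z /= zy; rewrite /swap0 zy.
Qed.

Lemma swap0_asymp (N : nat) (a b : 'I_N) (y : full_shift N) :
  (y, swap0 a b y) \in asymp_at 1.
Proof. by rewrite inE => i i1 /=; rewrite /swap0; case: eqP i1 => // ->. Qed.

Definition swap0_pair (N : nat) (a b : 'I_N) (y : full_shift N) :
    asymp_groupoid N :=
  asymp_incl (exist _ (y, swap0 a b y) (swap0_asymp a b y)).

(** All these pairs lie in the single level [asymp_at 1], so an open set of the inductive limit need
    only be tested there, in the relative topology. *)
Lemma swap0_pair_continuous (N : nat) (a b : 'I_N) :
  continuous (swap0_pair a b).
Proof.
apply/continuousP => U; rewrite asymp_groupoid_openE => /(_ 1%N)[V oV VU].
pose s y : set_type (@asymp_at N 1) :=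
  exist _ (y, swap0 a b y) (swap0_asymp a b y).
rewrite -[X in open X]/(s @^-1` (@asymp_incl N 1 @^-1` U)) -VU.
rewrite -[X in open X]/((fun y => (y, swap0 a b y)) @^-1` V).
move: V oV {VU}; apply/continuousP => y.
apply: (@cvg_pair _ _ _ (nbhs y) (nbhs y) (nbhs (swap0 a b y)) _ _ _ id).
  exact: cvg_id.
exact: swap0_continuous.
Qed.

(** Inside level [m] only the finitely many coordinates with [n <= |i| < m] remain to be compared,
    which is an open condition. *)
Lemma asymp_at_open (N n : nat) :
  open [set p : asymp_groupoid N | asymp_at n (agval p)].
Proof.
rewrite asymp_groupoid_openE => m.
pose D := [set p : full_shift N * full_shift N |
  forall i, (n <= `|i|)%N -> (`|i| < m)%N -> p.1 i = p.2 i].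
exists D.
  rewrite openE => -[x z] Dxz.
  exists ([set x' | agree m x x'], [set z' | agree m z z']).
    by split; exact: near_agree.
  move=> [x' z'] /= [xx' zz'] i ni im.
  rewrite /=.
  by rewrite -xx' ?(ltnW im)// -zz' ?(ltnW im)//; exact: Dxz.
apply/seteqP; split=> p /= Dp i ni; last by move=> _; exact: Dp.
have [im|im] := ltnP `|i|%N m; first exact: Dp.
by have := valP p; rewrite inE; exact.
Qed.

Lemma near_Zdisc (T : topologicalType) (f : T -> int) (x : T) :
  continuous (f : T -> Zdisc) -> \forall z \near x, f z = f x.
Proof. by move=> fc; exact: (fc x _ (@discrete_set1 Zdisc (f x))). Qed.

Lemma near_coord (T : topologicalType) (N : nat) (f : T -> full_shift N)
    (i : int) (x : T) :
  continuous f -> \forall z \near x, f z i = f x i.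
Proof. by move=> fc; exact: (fc x _ (near_eq_coord (f x) i)). Qed.

(** * Equal cylinder counts and divisibility *)

Lemma near_card_cylinder_le (M N : nat) (h : full_shift M -> full_shift N)
    (k : full_shift N -> full_shift M) (d : asymp_groupoid N -> int)
    (F : asymp_groupoid N -> asymp_groupoid M) (a b : 'I_N) :
  cancel h k -> cancel k h -> continuous h -> continuous k ->
  continuous (d : asymp_groupoid N -> Zdisc) ->
  continuous_pairing (fun q => shiftz (d q) (k (asrc q)))
    (fun q => k (atgt q)) F ->
  \forall S \near \oo,
    (#|[pred f : {ffun 'I_S.*2.+1 -> 'I_M} | h (per f) 0 == a]| <=
     #|[pred f : {ffun 'I_S.*2.+1 -> 'I_M} | h (per f) 0 == b]|)%N.
Proof.
move=> hK kK hc kc dc [Fc FE].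
pose theta x := k (swap0 a b (h x)).
pose r x := swap0_pair a b (h x).
pose e x := d (r x).
have rc : continuous r.
  by move=> x; apply: continuous_comp; [exact: hc|exact: swap0_pair_continuous].
have thetac : continuous theta.
  move=> x; apply: continuous_comp; last exact: kc.
  by apply: continuous_comp; [exact: hc|exact: swap0_continuous].
have ec : continuous (e : full_shift M -> Zdisc).
  by move=> x; apply: continuous_comp; [exact: rc|exact: dc].
have thetaK : involutive theta by move=> x; rewrite /theta kK swap0K hK.
(* The pairing is evaluated at [h x] and its exchanged copy; [k] sends [h x] back to [x]. *)
have FrE x : agval (F (r x)) = (shiftz (e x) x, theta x).
  by rewrite FE /asrc /atgt /= hK.
(* Each [F (r x)] lies in some level; levels are open and [F \o r] is continuous, so compactness
   yields a common level. *)
have: \forall L \near \oo, forall x, asymp_at L (shiftz (e x) x, theta x).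
  apply: full_shift_near => x.
  have [n _ xn] : asymp (agval (F (r x))).
    by have := valP (F (r x)); rewrite inE.
  have Frn : \forall z \near x, asymp_at n (agval (F (r z))).
    have Frc : {for x, continuous (F \o r)}.
      by apply: continuous_comp; [exact: rc|exact: Fc].
    apply: (Frc [set p | asymp_at n (agval p)]); apply: open_nbhs_nbhs.
    by split; first exact: asymp_at_open.
  exists ([set z | asymp_at n (agval (F (r z)))], [set L | n <= L]%N).
    by split => //; exact: nbhs_infty_ge.
  move=> [z L] /= [zn nL] i iL; rewrite -FrE; apply: zn; exact: leq_trans iL.
move=> /filter_ex[L thetaL].
have thetaE x i : (L <= `|i|)%N -> theta x i = x (i + e x).
  by move=> /(thetaL x i) /= <-; rewrite shiftzE.
have : \forall K \near \oo, [/\ forall x, (`|e x| <= K)%N,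
    forall x z, agree K x z -> e x = e z,
    forall x z, agree K x z -> agree L (theta x) (theta z) &
    forall x z, agree K x z -> h x 0 = h z 0].
  near=> K; split; near: K.
  - apply: (@locally_constant_bounded _ (fun x => `|e x|%N)) => x.
    by apply: filterS (near_Zdisc x ec) => z /= ->.
  - by apply: uniformly_locally_constant => x; exact: near_Zdisc.
  - have : \forall K \near \oo, forall j : 'I_L.+1, forall x z, agree K x z ->
        (theta x j%:Z, theta x (- j%:Z)) = (theta z j%:Z, theta z (- j%:Z)).
      apply: filter_forall => j; apply: uniformly_locally_constant => x.
      by apply: filterS2 (near_coord j%:Z x thetac)
        (near_coord (- j%:Z) x thetac) => z /= -> ->.
    apply: filterS => K thK x z xz i iL.
    have := thK (Ordinal (iL : (`|i| < L.+1)%N)) x z xz.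
    by case: (intP i) iL => [|n|n] _ /=; rewrite ?abszN ?absz_nat => -[].
  - by apply: uniformly_locally_constant => x; exact: near_coord.
move=> /filter_ex[K [eK eloc thloc hloc]].
near=> S; apply: (@card_per_le _ L K S theta e
  (fun x => h x 0 == a) (fun x => h x 0 == b)) => //.
- by move=> x /eqP hxa; rewrite /theta kK /swap0 eqxx hxa tpermL.
- by move=> x z /hloc ->.
- by near: S; exact: nbhs_infty_ge.
Unshelve. all: by end_near. Qed.

(** For large [S], the letter of [h (per f)] at 0 splits the [M ^ S.*2.+1] words [f] into [N]
    classes; comparing every pair of letters both ways makes them equal in size. *)
Lemma acoe_dvdn (M N : nat) (h : full_shift M -> full_shift N)
    (k : full_shift N -> full_shift M) (d : asymp_groupoid N -> int)
    (F : asymp_groupoid N -> asymp_groupoid M) :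
  cancel h k -> cancel k h -> continuous h -> continuous k ->
  continuous (d : asymp_groupoid N -> Zdisc) ->
  continuous_pairing (fun q => shiftz (d q) (k (asrc q)))
    (fun q => k (atgt q)) F ->
  (0 < N)%N -> exists n, (N %| M ^ n)%N.
Proof.
move=> hK kK hc kc dc Fc; case: N h k d F hK kK hc kc dc Fc => // N.
move=> h k d F hK kK hc kc dc Fc _.
have : \forall S \near \oo, forall a b : 'I_N.+1,
    (#|[pred f : {ffun 'I_S.*2.+1 -> 'I_M} | h (per f) 0 == a]| <=
     #|[pred f : {ffun 'I_S.*2.+1 -> 'I_M} | h (per f) 0 == b]|)%N.
  apply: filter_forall => a; apply: filter_forall => b.
  exact: near_card_cylinder_le Fc.
move=> /filter_ex[S cardS]; exists S.*2.+1.
rewrite -{1}(card_ord M) -{1}(card_ord S.*2.+1) -card_ffun -sum1_card.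
rewrite (partition_big (fun f => h (per f) 0 : 'I_N.+1) xpredT)//=.
rewrite (eq_bigr (fun=> #|[pred f : {ffun 'I_S.*2.+1 -> 'I_M} |
    h (per f) 0 == ord0]|)); last first.
  by move=> a _; rewrite sum1_card; apply/eqP; rewrite eqn_leq !cardS.
by rewrite sum_nat_const card_ord dvdn_mulr.
Qed.

(** * Comparison of prime factors *)

Lemma prime_dvd_prod_pow (m v : nat) (p k : 'I_m -> nat) :
  (forall i, prime (p i)) -> (forall i, (0 < k i)%N) -> prime v ->
  (v %| \prod_(i < m) p i ^ k i)%N -> range p v.
Proof.
move=> pp kp vp; rewrite Euclid_dvd_prod// big_has => /hasP[i _].
rewrite Euclid_dvdX// => /andP[+ _]; rewrite dvdn_prime2// => /eqP ->.
by exists i.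
Qed.

Lemma primes_sub (M N m n : nat) (p k : 'I_m -> nat) (q l : 'I_n -> nat) :
  (forall i, prime (p i)) -> (forall j, prime (q j)) ->
  (forall i, (0 < k i)%N) -> (forall j, (0 < l j)%N) ->
  M = (\prod_(i < m) p i ^ k i)%N -> N = (\prod_(j < n) q j ^ l j)%N ->
  (exists s, (M %| N ^ s)%N) -> range p `<=` range q.
Proof.
move=> pp qp kp lp ME NE [s MN] _ [i _ <-].
apply: prime_dvd_prod_pow lp _ _ => //; rewrite -NE.
have : (p i %| N ^ s)%N.
  apply: dvdn_trans MN; rewrite ME (bigD1 i)//= dvdn_mulr//.
  by rewrite dvdn_exp.
by rewrite Euclid_dvdX// => /andP[].
Qed.

Theorem corollary10p6 (M N m n : nat)
    (p k : 'I_m -> nat) (q l : 'I_n -> nat)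
    (M_gt1 : (1 < M)%N) (N_gt1 : (1 < N)%N)
    (p_prime : forall i, prime (p i)) (q_prime : forall j, prime (q j))
    (p_incr : forall i i' : 'I_m, (i < i')%N -> (p i < p i')%N)
    (q_incr : forall j j' : 'I_n, (j < j')%N -> (q j < q j')%N)
    (k_gt0 : forall i, (0 < k i)%N) (l_gt0 : forall j, (0 < l j)%N)
    (M_fact : M = (\prod_(i < m) p i ^ k i)%N)
    (N_fact : N = (\prod_(j < n) q j ^ l j)%N)
    (primes_neq : range p <> range q) :
  ~ asymp_cont_orbit_equiv M N.
Proof.
move=> [h [g [c1 [c2 [d1 [d2 [Fi [Fii [Fiii [Fiv acoe]]]]]]]]]].
have [hK gK hc gc _ _ [d1c _] [d2c _] _ _ _ _ Fiiic Fivc _ _ _ _] := acoe.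
apply: primes_neq; apply/seteqP; split.
  (* Condition (iii) is condition (iv) with [h] and its inverse exchanged, so [acoe_dvdn] gives
     divisibility in both directions. *)
  apply: (primes_sub _ _ _ _ M_fact N_fact) => //.
  exact: acoe_dvdn Fiiic (ltnW M_gt1).
apply: (primes_sub _ _ _ _ N_fact M_fact) => //.
exact: acoe_dvdn Fivc (ltnW N_gt1).
Qed.
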